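(* Consider a model structure on the category $\mathbf{CSTS}_\bullet$ of star-shaped transition systems such that all $\mathcal P$-cell complexes are cofibrant and such that all $\mathcal P$-injective maps are weak equivalences. Then there exist two $\mathcal P$-cell complexes which are homotopy equivalent in this model structure and which are not $\mathcal P$-bisimilar. In particular, this model structure is not $\mathcal P$-causal.
   Context: Fix an infinite set $\Sigma$ of labels. A transition presystem $X$ consists of a set $S(X)$ of states, a set $L(X)$ of actions with a labelling map $\mu:L(X)\to\Sigma$, and for each $n\geq 1$ a set $T_n(X)\subset S(X)\times L(X)^n\times S(X)$ of $n$-transitions. A map $f:X\to Y$ consists of a map $S(X)\to S(Y)$ and a label-preserving map $L(X)\to L(Y)$ such that the image $(f(\alpha),f(u_1),\dots,f(u_n),f(\beta))$ of every transition $(\alpha,u_1,\dots,u_n,\beta)$ of $X$ is a transition of $Y$. A Cattani-Sassone transition system is a transition presystem satisfying: (Multiset) if $(\alpha,u_1,\dots,u_n,\beta)$ is a transition with $n\geq2$, so is $(\alpha,u_{\sigma(1)},\dots,u_{\sigma(n)},\beta)$ for every permutation $\sigma$; (Patching) for $n\geq 3$, $p,q\geq 1$, $p+q<n$, if $(\alpha,u_1,\dots,u_n,\beta)$, $(\alpha,u_1,\dots,u_p,\nu_1)$, $(\nu_1,u_{p+1},\dots,u_n,\beta)$, $(\alpha,u_1,\dots,u_{p+q},\nu_2)$, $(\nu_2,u_{p+q+1},\dots,u_n,\beta)$ are transitions, so is $(\nu_1,u_{p+1},\dots,u_{p+q},\nu_2)$; (All actions used) every action $u$ occurs in some $1$-transition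 $(\alpha,u,\beta)$; (CSA2) for every transition $(\alpha,u_1,\dots,u_n,\beta)$ with $n\geq 2$ and every $1\leq p<n$ there is a unique state $\nu$ such that $(\alpha,u_1,\dots,u_p,\nu)$ and $(\nu,u_{p+1},\dots,u_n,\beta)$ are transitions; (CSA1) if $(\alpha,u,\beta)$ and $(\alpha,v,\beta)$ are transitions with $\mu(u)=\mu(v)$, then $u=v$. A pointed transition system $(X,* )$ is a Cattani-Sassone transition system $X$ with a distinguished state $*$ (base state); maps preserve base states. For $w=x_1\dots x_n\in\Sigma^n$, $n\geq0$, the path $(P(w),0)$ has states $0,\dots,n$, base state $0$, actions $(x_i,i)$ with label $x_i$, and transitions $(i-1,(x_i,i),i)$, $1\leq i\leq n$. $(X,* )$ is star-shaped if every state is the image of $n$ under some map $(P(w),0)\to(X,* )$ with $w\in\Sigma^n$, $n\geq0$. $\mathbf{CSTS}_\bullet$ is the category of star-shaped transition systems; its initial object is the one-state object $(\{*\},* )$. Let $\Sigma^*=\bigcup_{n\geq0}\Sigma^n$ and let $\mathcal P=\{(P(w),0)\to(P(ww'),0)\mid w,w'\in\Sigma^*\}$ be the set of extensions of paths (inclusions as initial segments). A map of $\mathbf{CSTS}_\bullet$ is $\mathcal P$-injective if it has the right lifting property with respect to every map of $\mathcal P$. A $\mathcal P$-cell complex is an object $(X,* )$ such that the map from the initial object to $(X,* )$ is a transfinite composition of pushouts of maps of $\mathcal P$. Two star-shaped transition systems $(X,* )$, $(Y,* )$ are $\mathcal P$-bisimilar if there is a span of $\mathcal P$-injective maps $(X,*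 )\leftarrow(Z,* )\rightarrow(Y,* )$. Two objects $A,B$ of a model category are homotopy equivalent here if there are maps $f:A\to B$, $g:B\to A$ such that $gf$ is homotopic (both left and right homotopic) to $\mathrm{Id}_A$ and $fg$ is homotopic to $\mathrm{Id}_B$. A class of star-shaped transition systems, the realizations of process algebras (for a fixed semantics), is given; the only property of it to be used is that every $\mathcal P$-cell complex is a realization of a process algebra. A model structure on $\mathbf{CSTS}_\bullet$ is $\mathcal P$-causal if any two star-shaped transition systems realizing process algebras are weakly equivalent if and only if they are $\mathcal P$-bisimilar. *)

(* Defs.v *)
From Stdlib Require Import List Permutation FinFun Relations Arith Lia.
From Stdlib Require Import ProofIrrelevance FunctionalExtensionality.
Import ListNotations.

Set Implicit Arguments.
Unset Strict Implicit.

Record category := Category {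
  ob : Type;
  hom : ob -> ob -> Type;
  id : forall A, hom A A;
  comp : forall A B C, hom B C -> hom A B -> hom A C;
  comp_id_l : forall A B (f : hom A B), comp (id B) f = f;
  comp_id_r : forall A B (f : hom A B), comp f (id A) = f;
  comp_assoc : forall A B C D (h : hom C D) (g : hom B C) (f : hom A B),
    comp h (comp g f) = comp (comp h g) f }.

Arguments hom {c} _ _.
Arguments id {c} _.
Arguments comp {c A B C} _ _.

Declare Scope cat_scope.
Delimit Scope cat_scope with cat.
Notation "g ∘ f" := (comp g f) (at level 40, left associativity) : cat_scope.
Local Open Scope cat_scope.

Definition map_class (C : category) := forall A B : ob C, hom A B -> Prop.

Section Category.
Variable C : category.

Definition is_initial (O : ob C) : Prop :=
  forall X, exists! f : hom O X, True.

Definition is_coproduct (A B S : ob C) (i : hom A S) (j : hom B S) : Prop :=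
  forall Z (f : hom A Z) (g : hom B Z),
    exists! h : hom S Z, h ∘ i = f /\ h ∘ j = g.

Definition is_product (A B Q : ob C) (p : hom Q A) (q : hom Q B) : Prop :=
  forall Z (f : hom Z A) (g : hom Z B),
    exists! h : hom Z Q, p ∘ h = f /\ q ∘ h = g.

(** [g : X -> Y] is the pushout of [f : A -> B] along [a : A -> X]. *)
Definition is_pushout (A B X Y : ob C)
    (f : hom A B) (a : hom A X) (b : hom B Y) (g : hom X Y) : Prop :=
  b ∘ f = g ∘ a /\
  forall Z (u : hom B Z) (v : hom X Z), u ∘ f = v ∘ a ->
    exists! h : hom Y Z, h ∘ b = u /\ h ∘ g = v.

Definition pushout_of (J : map_class C) : map_class C :=
  fun X Y g => exists (A B : ob C) (f : hom A B) (a : hom A X) (b : hom B Y),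
    J A B f /\ is_pushout f a b g.

Definition lifts (A B X Y : ob C) (i : hom A B) (p : hom X Y) : Prop :=
  forall (f : hom A X) (g : hom B Y), p ∘ f = g ∘ i ->
    exists h : hom B X, h ∘ i = f /\ p ∘ h = g.

Definition injective (J : map_class C) : map_class C :=
  fun X Y p => forall A B (i : hom A B), J A B i -> lifts i p.

(** [is_retract f g] says that [f] is a retract of [g]. *)
Definition is_retract (A B X Y : ob C) (f : hom A B) (g : hom X Y) : Prop :=
  exists (i : hom A X) (r : hom X A) (i' : hom B Y) (r' : hom Y B),
    r ∘ i = id A /\ r' ∘ i' = id B /\ g ∘ i = i' ∘ f /\ f ∘ r = r' ∘ g.

(** Ordinals are represented by well-ordered types. *)
Record well_order (I : Type) (le : I -> I -> Prop) : Prop := WellOrder {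
  wo_refl : forall i, le i i;
  wo_antisym : forall i j, le i j -> le j i -> i = j;
  wo_trans : forall i j k, le i j -> le j k -> le i k;
  wo_least : forall P : I -> Prop, (exists i, P i) ->
    exists i, P i /\ forall j, P j -> le i j }.

Section Chains.
Variables (I : Type) (le : I -> I -> Prop).

Definition strict (i j : I) : Prop := le i j /\ i <> j.

Definition is_least (i : I) : Prop := forall j, le i j.

Definition is_succ (i j : I) : Prop :=
  strict i j /\ forall k, strict i k -> le j k.

Definition is_limit (j : I) : Prop :=
  ~ is_least j /\ ~ exists i, is_succ i j.

Record chain := Chain {
  ch_ob : I -> ob C;
  ch_map : forall i j, le i j -> hom (ch_ob i) (ch_ob j);
  ch_id : forall i (h : le i i), ch_map h = id (ch_ob i);
  ch_comp : forall i j k (hij : le i j) (hjk : le j k) (hik : le i k),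
    ch_map hjk ∘ ch_map hij = ch_map hik }.

(** [Y], with the maps [c], is the colimit of the restriction of the chain [X]
    to the indices satisfying [D]. *)
Definition is_cocone (X : chain) (D : I -> Prop) (Y : ob C)
    (c : forall i, D i -> hom (ch_ob X i) Y) : Prop :=
  forall i j (h : le i j) (di : D i) (dj : D j), c j dj ∘ ch_map X h = c i di.

Definition is_colimit (X : chain) (D : I -> Prop) (Y : ob C)
    (c : forall i, D i -> hom (ch_ob X i) Y) : Prop :=
  is_cocone c /\
  forall Z (d : forall i, D i -> hom (ch_ob X i) Z), is_cocone d ->
    exists! h : hom Y Z, forall i (di : D i), h ∘ c i di = d i di.

End Chains.

(** [transfinite_composition K A B f]: [f] is the map from the first object to
    the colimit of a chain that is indexed by a nonempty ordinal, is continuous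
    at limit stages, and has its successor maps in [K]. *)
Inductive transfinite_composition (K : map_class C) : map_class C :=
| TransfiniteComposition :
    forall (I : Type) (le : I -> I -> Prop) (X : chain le) (i0 : I)
      (Y : ob C) (c : forall i, True -> hom (ch_ob X i) Y),
    well_order le ->
    is_least le i0 ->
    (forall i j (h : le i j), is_succ le i j -> K _ _ (ch_map X h)) ->
    (forall j, is_limit le j ->
       is_colimit (D := fun i => strict le i j)
         (fun i (h : strict le i j) => ch_map X (proj1 h))) ->
    is_colimit (D := fun _ => True) c ->
    transfinite_composition K (c i0 Logic.I).

Definition cell_complex (J : map_class C) (X : ob C) : Prop :=
  exists (O : ob C) (i : hom O X),
    is_initial O /\ transfinite_composition (pushout_of J) i.

Definition bisimilar (J : map_class C) (X Y : ob C) : Prop :=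
  exists (Z : ob C) (p : hom Z X) (q : hom Z Y),
    injective J p /\ injective J q.

End Category.

Arguments chain C {I} le.

Definition two_out_of_three (C : category) (W : map_class C) : Prop :=
  forall (X Y Z : ob C) (f : hom X Y) (g : hom Y Z),
    (W _ _ f -> W _ _ g -> W _ _ (g ∘ f)) /\
    (W _ _ f -> W _ _ (g ∘ f) -> W _ _ g) /\
    (W _ _ g -> W _ _ (g ∘ f) -> W _ _ f).

Definition retract_closed (C : category) (K : map_class C) : Prop :=
  forall (A B X Y : ob C) (f : hom A B) (g : hom X Y),
    is_retract f g -> K _ _ g -> K _ _ f.

(** Existence of limits and colimits concerns the category only, and is not part
    of the structure.  Factorizations are not required to be functorial. *)
Record model_structure (C : category) := ModelStructure {
  weq : map_class C;
  cof : map_class C;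
  fib : map_class C;
  weq_two_out_of_three : two_out_of_three weq;
  weq_retract : retract_closed weq;
  cof_retract : retract_closed cof;
  fib_retract : retract_closed fib;
  cof_lifts_trivial_fib : forall (A B X Y : ob C) (i : hom A B) (p : hom X Y),
    cof i -> fib p -> weq p -> lifts i p;
  trivial_cof_lifts_fib : forall (A B X Y : ob C) (i : hom A B) (p : hom X Y),
    cof i -> weq i -> fib p -> lifts i p;
  factor_cof_trivial_fib : forall (X Y : ob C) (f : hom X Y),
    exists (Z : ob C) (i : hom X Z) (p : hom Z Y),
      cof i /\ fib p /\ weq p /\ p ∘ i = f;
  factor_trivial_cof_fib : forall (X Y : ob C) (f : hom X Y),
    exists (Z : ob C) (i : hom X Z) (p : hom Z Y),
      cof i /\ weq i /\ fib p /\ p ∘ i = f }.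

Section ModelStructure.
Variables (C : category) (M : model_structure C).

Definition cofibrant (X : ob C) : Prop :=
  exists (O : ob C) (i : hom O X), is_initial O /\ cof M i.

(** A factorization of the codiagonal [A ⊔ A -> A] as a cofibration followed by
    a weak equivalence. *)
Record cylinder (A : ob C) := Cylinder {
  cyl_sum : ob C;
  cyl_in0 : hom A cyl_sum;
  cyl_in1 : hom A cyl_sum;
  cyl_sumP : is_coproduct cyl_in0 cyl_in1;
  cyl_ob : ob C;
  cyl_incl : hom cyl_sum cyl_ob;
  cyl_proj : hom cyl_ob A;
  cyl_incl_cof : cof M cyl_incl;
  cyl_proj_weq : weq M cyl_proj;
  cyl_codiag0 : cyl_proj ∘ cyl_incl ∘ cyl_in0 = id A;
  cyl_codiag1 : cyl_proj ∘ cyl_incl ∘ cyl_in1 = id A }.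

(** A factorization of the diagonal [B -> B × B] as a weak equivalence followed
    by a fibration. *)
Record path_object (B : ob C) := PathObject {
  po_prod : ob C;
  po_pr0 : hom po_prod B;
  po_pr1 : hom po_prod B;
  po_prodP : is_product po_pr0 po_pr1;
  po_ob : ob C;
  po_const : hom B po_ob;
  po_ends : hom po_ob po_prod;
  po_const_weq : weq M po_const;
  po_ends_fib : fib M po_ends;
  po_diag0 : po_pr0 ∘ po_ends ∘ po_const = id B;
  po_diag1 : po_pr1 ∘ po_ends ∘ po_const = id B }.

Definition left_homotopic (A B : ob C) (f g : hom A B) : Prop :=
  exists (K : cylinder A) (H : hom (cyl_ob K) B),
    H ∘ cyl_incl K ∘ cyl_in0 K = f /\ H ∘ cyl_incl K ∘ cyl_in1 K = g.

Definition right_homotopic (A B : ob C) (f g : hom A B) : Prop :=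
  exists (K : path_object B) (H : hom A (po_ob K)),
    po_pr0 K ∘ po_ends K ∘ H = f /\ po_pr1 K ∘ po_ends K ∘ H = g.

Definition homotopic (A B : ob C) (f g : hom A B) : Prop :=
  left_homotopic f g /\ right_homotopic f g.

Definition homotopy_equivalent (A B : ob C) : Prop :=
  exists (f : hom A B) (g : hom B A),
    homotopic (g ∘ f) (id A) /\ homotopic (f ∘ g) (id B).

(** Connected by a finite zigzag of weak equivalences, i.e. isomorphic in the
    homotopy category. *)
Definition weakly_equivalent : ob C -> ob C -> Prop :=
  clos_refl_sym_trans (ob C) (fun X Y => exists f : hom X Y, weq M f).

End ModelStructure.

Section TransitionSystems.
Variable Sigma : Type.

(** [trans a us b] with [us] of length [n] is an [n]-transition. *)
Record presystem := Presystem {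
  state : Type;
  action : Type;
  label : action -> Sigma;
  trans : state -> list action -> state -> Prop;
  trans_nonempty : forall a b, ~ trans a [] b }.

Record system_map (X Y : presystem) := SystemMap {
  on_state : state X -> state Y;
  on_action : action X -> action Y;
  on_label : forall u, label (on_action u) = label u;
  on_trans : forall a us b, trans a us b ->
    trans (on_state a) (map on_action us) (on_state b) }.

(** In [csts_patching] the lists [u], [v], [w] have lengths [p], [q] and
    [n - p - q]. *)
Record is_csts (X : presystem) : Prop := IsCsts {
  csts_multiset : forall (a b : state X) (us vs : list (action X)),
    length us >= 2 -> Permutation us vs -> trans a us b -> trans a vs b;
  csts_patching : forall (a b n1 n2 : state X) (u v w : list (action X)),
    u <> [] -> v <> [] -> w <> [] ->
    trans a (u ++ v ++ w) b ->
    trans a u n1 -> trans n1 (v ++ w) b ->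
    trans a (u ++ v) n2 -> trans n2 w b ->
    trans n1 v n2;
  csts_all_actions_used : forall u : action X, exists a b, trans a [u] b;
  csts_CSA2 : forall (a b : state X) (u v : list (action X)),
    u <> [] -> v <> [] -> trans a (u ++ v) b ->
    exists! n, trans a u n /\ trans n v b;
  csts_CSA1 : forall (a b : state X) (u v : action X),
    trans a [u] b -> trans a [v] b -> label u = label v -> u = v }.

Record pointed := Pointed {
  underlying :> presystem;
  underlying_csts : is_csts underlying;
  base : state underlying }.

Record pointed_map (X Y : pointed) := PointedMap {
  underlying_map :> system_map X Y;
  on_base : on_state underlying_map (base X) = base Y }.

Lemma pointed_map_ext (X Y : pointed) (f g : pointed_map X Y) :
  (forall a, on_state f a = on_state g a) ->
  (forall u, on_action f u = on_action g u) -> f = g.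
Proof.
  destruct f as [[fs fa fl ft] fb], g as [[gs ga gl gt] gb]; simpl.
  intros Hs Ha.
  apply functional_extensionality in Hs. apply functional_extensionality in Ha.
  subst gs ga.
  rewrite (proof_irrelevance _ gl fl), (proof_irrelevance _ gt ft).
  f_equal. apply proof_irrelevance.
Qed.

Definition system_map_id (X : presystem) : system_map X X.
Proof.
  refine (@SystemMap X X (fun a => a) (fun u => u) (fun u => eq_refl) _).
  intros a us b H. rewrite map_id. exact H.
Defined.

Definition system_map_comp (X Y Z : presystem)
    (g : system_map Y Z) (f : system_map X Y) : system_map X Z.
Proof.
  refine (@SystemMap X Z (fun a => on_state g (on_state f a))
    (fun u => on_action g (on_action f u))
    (fun u => eq_trans (on_label g (on_action f u)) (on_label f u)) _).
  intros a us b H.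
  rewrite <- map_map. apply on_trans, on_trans, H.
Defined.

Definition pointed_map_id (X : pointed) : pointed_map X X :=
  @PointedMap X X (system_map_id X) eq_refl.

Definition pointed_map_comp (X Y Z : pointed)
    (g : pointed_map Y Z) (f : pointed_map X Y) : pointed_map X Z :=
  @PointedMap X Z (system_map_comp g f)
    (eq_trans (f_equal (on_state g) (on_base f)) (on_base g)).

(** For [w = x_1 ... x_n], the action [(x_i, i)] is encoded as [(x_i, i - 1)],
    so that it goes from the state [i - 1] to the state [i]. *)

Definition path_presystem (w : list Sigma) : presystem.
Proof.
  refine (@Presystem {k : nat | k <= length w}
    {u : Sigma * nat | nth_error w (snd u) = Some (fst u)}
    (fun u => fst (proj1_sig u))
    (fun a us b => exists u, us = [u] /\
       proj1_sig a = snd (proj1_sig u) /\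
       proj1_sig b = S (snd (proj1_sig u))) _).
  intros a b [u [H _]]. discriminate H.
Defined.

Lemma path_csts (w : list Sigma) : is_csts (path_presystem w).
Proof.
  constructor.
  - intros a b us vs Hlen _ [u [-> _]]. simpl in Hlen. lia.
  - intros a b n1 n2 [|x u] [|y v] z Hu Hv _ [t [E _]]; try congruence.
    destruct u; discriminate E.
  - intros [[x i] Hi]; simpl in Hi.
    assert (Hlt : i < length w) by (apply nth_error_Some; congruence).
    exists (exist _ i (Nat.lt_le_incl _ _ Hlt)), (exist _ (S i) Hlt).
    exists (exist _ (x, i) Hi). auto.
  - intros a b [|x u] [|y v] Hu Hv [t [E _]]; try congruence.
    destruct u; discriminate E.
  - intros a b [[x i] Hi] [[y j] Hj] [t [E [Ha _]]] [t' [E' [Ha' _]]] Hl.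
    injection E as <-. injection E' as <-. simpl in *. subst y.
    apply eq_sig_hprop; [intros; apply proof_irrelevance|simpl; congruence].
Qed.

Definition path_pointed (w : list Sigma) : pointed :=
  Pointed (path_csts w)
    (exist (fun k => k <= length w) 0 (Nat.le_0_l _) : state (path_presystem w)).

Definition path_end (w : list Sigma) : state (path_pointed w) :=
  exist (fun k => k <= length w) (length w) (le_n _).

Definition star_shaped (X : pointed) : Prop :=
  forall a : state X, exists (w : list Sigma) (f : pointed_map (path_pointed w) X),
    on_state f (path_end w) = a.

Definition path_incl (w w' : list Sigma) :
  pointed_map (path_pointed w) (path_pointed (w ++ w')).
Proof.
  unshelve refine (@PointedMap (path_pointed w) (path_pointed (w ++ w'))
    (@SystemMap (path_presystem w) (path_presystem (w ++ w'))
      (fun a => exist _ (proj1_sig a) _)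
      (fun u => exist _ (proj1_sig u) _) (fun u => eq_refl) _) _).
  - destruct a as [k Hk]; simpl. rewrite length_app. lia.
  - destruct u as [[x i] Hi]; simpl in *. rewrite nth_error_app1; [exact Hi|].
    apply nth_error_Some. congruence.
  - intros a us b [u [-> [Ha Hb]]]; simpl. eexists. split; [reflexivity|].
    simpl. split; assumption.
  - simpl. f_equal. apply proof_irrelevance.
Defined.

Lemma path_star_shaped (w : list Sigma) : star_shaped (path_pointed w).
Proof.
  intros [k Hk].
  assert (G : forall (v v' : list Sigma) (Hv : length v <= length (v ++ v')),
    exists (u : list Sigma)
      (f : pointed_map (path_pointed u) (path_pointed (v ++ v'))),
      on_state f (path_end u) = exist _ (length v) Hv).
  { intros v v' Hv. exists v, (path_incl v v'). unfold path_end; simpl.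
    apply eq_sig_hprop; [intros; apply proof_irrelevance|reflexivity]. }
  generalize (G (firstn k w) (skipn k w)).
  rewrite firstn_skipn, length_firstn, Nat.min_l by exact Hk.
  intros H. apply H.
Qed.

Record star_system := StarSystem {
  star_pointed :> pointed;
  star_shapedP : star_shaped star_pointed }.

Definition CSTS_star : category.
Proof.
  refine (@Category star_system (fun X Y => pointed_map X Y)
    (fun X => pointed_map_id X) (fun X Y Z g f => pointed_map_comp g f) _ _ _);
  intros; apply pointed_map_ext; reflexivity.
Defined.

Definition path (w : list Sigma) : ob CSTS_star :=
  StarSystem (@path_star_shaped w).

Inductive path_extension : map_class CSTS_star :=
| PathExtension : forall w w' : list Sigma,
    @path_extension (path w) (path (w ++ w')) (path_incl w w').

(** [realizes] is the class of realizations of process algebras. *)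
Definition causal (realizes : ob CSTS_star -> Prop)
    (M : model_structure CSTS_star) : Prop :=
  forall X Y : ob CSTS_star, realizes X -> realizes Y ->
    (weakly_equivalent M X Y <-> bisimilar path_extension X Y).

Definition point_presystem : presystem :=
  @Presystem unit Empty_set (fun u => match u with end)
    (fun _ _ _ => False) (fun _ _ H => H).

Lemma point_csts : is_csts point_presystem.
Proof.
  constructor; simpl; contradiction.
Qed.

Definition point_pointed : pointed :=
  Pointed point_csts (tt : state point_presystem).

Lemma point_star_shaped : star_shaped point_pointed.
Proof.
  intros [].
  unshelve eexists [], (@PointedMap (path_pointed []) point_pointed
    (@SystemMap (path_presystem []) point_presystem (fun _ => tt) _ _ _) _).
  - intros [[x i] Hi]. destruct i; discriminate Hi.
  - intros [[x i] Hi]. exfalso. destruct i; discriminate Hi.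
  - intros a us b [[[x i] Hi] _]. exfalso. destruct i; discriminate Hi.
  - reflexivity.
  - reflexivity.
Qed.

Definition point : ob CSTS_star := StarSystem point_star_shaped.

Lemma point_initial : is_initial point.
Proof.
  intros X.
  unshelve eexists (@PointedMap point_pointed X
    (@SystemMap point_presystem X (fun _ => base X)
       (fun u => match u with end) _ _) _).
  - intros [].
  - intros a us b [].
  - reflexivity.
  - split; [exact Logic.I|]. intros g _. apply pointed_map_ext.
    + intros []. symmetry. exact (on_base g).
    + intros [].
Qed.

End TransitionSystems.

Arguments path_extension {Sigma} A B _.

(* Main.v *)
(** For path extensions, the codiagonal [X + X -> X] of a wedge [X] of paths is
    injective: a path in [X + X] stays in one of the two summands, and its
    extension can be lifted there.  Hence [X + X] is a cylinder of [X], any two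
    maps out of [X] are left homotopic, and, [X] being cofibrant, they are also
    right homotopic.  So two wedges of paths are homotopy equivalent as soon as
    there are maps in both directions between them.  This is the case for the
    path [xx] and the wedge of the paths [xx] and [x], but only the latter can
    perform [x] and then stop. *)

Require Import Defs.
From Stdlib Require Import FinFun List Arith Lia Permutation Relations.
From Stdlib Require Import Classical ProofIrrelevance.
Import ListNotations.

Set Implicit Arguments.
Unset Strict Implicit.
Local Open Scope cat_scope.

(** * Initial objects, coproducts and lifting in an arbitrary category *)

Section CategoryLemmas.
Variable C : category.

Lemma initial_eq (O X : ob C) (f g : hom O X) : is_initial O -> f = g.
Proof.
  intros H. destruct (H X) as [h [_ Hu]].
  rewrite <- (Hu f Logic.I). exact (Hu g Logic.I).
Qed.

(** Precomposition with the split epimorphism [e] is injective, so uniqueness of maps passes from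
    [O] to its retract [O']. *)
Lemma initial_iso (O O' : ob C) (e : hom O O') (e' : hom O' O) :
  e ∘ e' = id O' -> is_initial O -> is_initial O'.
Proof.
  intros He HO X. destruct (HO X) as [h _].
  exists (h ∘ e'). split; [exact Logic.I|]. intros g _.
  rewrite (initial_eq h (g ∘ e) HO), <- comp_assoc, He. apply comp_id_r.
Qed.

Lemma coproduct_eq (A B S Z : ob C) (i : hom A S) (j : hom B S) (f g : hom S Z) :
  is_coproduct i j -> f ∘ i = g ∘ i -> f ∘ j = g ∘ j -> f = g.
Proof.
  intros H Hi Hj. destruct (H Z (g ∘ i) (g ∘ j)) as [h [_ Hu]].
  transitivity h; [symmetry|]; apply Hu; auto.
Qed.

Lemma product_eq (A B Q Z : ob C) (p : hom Q A) (q : hom Q B) (f g : hom Z Q) :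
  is_product p q -> p ∘ f = p ∘ g -> q ∘ f = q ∘ g -> f = g.
Proof.
  intros H Hp Hq. destruct (H Z (p ∘ g) (q ∘ g)) as [h [_ Hu]].
  transitivity h; [symmetry|]; apply Hu; auto.
Qed.

Lemma coproduct_iso (A B B' S : ob C) (i : hom A S) (j : hom B S)
    (e : hom B' B) (e' : hom B B') :
  e ∘ e' = id B -> e' ∘ e = id B' -> is_coproduct i j -> is_coproduct i (j ∘ e).
Proof.
  intros He He' H Z f g. destruct (H Z f (g ∘ e')) as [h [[Hi Hj] Hu]].
  exists h. repeat split.
  - exact Hi.
  - rewrite comp_assoc, Hj, <- comp_assoc, He'. apply comp_id_r.
  - intros k [Ki Kj]. apply Hu. split; [exact Ki|].
    rewrite <- Kj, <- !comp_assoc, He, comp_id_r. reflexivity.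
Qed.

(** Both composites start at the initial object, so the square commutes for free. This is how
    attaching a path at the base state becomes a coproduct. *)
Lemma coproduct_pushout (O A B S : ob C) (f : hom O B) (a : hom O A)
    (i : hom A S) (j : hom B S) :
  is_initial O -> is_coproduct i j -> is_pushout f a j i.
Proof.
  intros HO H. split; [apply initial_eq, HO|].
  intros Z u v _. destruct (H Z v u) as [h [[Hi Hj] Hu]].
  exists h. repeat split; auto. intros k [Kj Ki]. auto.
Qed.

Lemma injective_id (J : map_class C) (X : ob C) : injective J (id X).
Proof.
  intros A B i _ f g H. exists g.
  rewrite <- H, !comp_id_l. auto.
Qed.

(** A lifting problem whose source maps into one summand is solved inside that
    summand. *)
Lemma codiagonal_injective (J : map_class C) (X S : ob C) (i j : hom X S)
    (fold : hom S X) :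
  fold ∘ i = id X -> fold ∘ j = id X ->
  (forall A B (u : hom A B), J A B u -> forall f : hom A S,
    i ∘ fold ∘ f = f \/ j ∘ fold ∘ f = f) ->
  injective J fold.
Proof.
  intros Hi Hj H A B u Ju f g E.
  assert (lift : forall k : hom X S, fold ∘ k = id X -> k ∘ fold ∘ f = f ->
    exists h, h ∘ u = f /\ fold ∘ h = g).
  { intros k Hk Hf. exists (k ∘ g). split.
    - rewrite <- comp_assoc, <- E, comp_assoc. exact Hf.
    - rewrite comp_assoc, Hk. apply comp_id_l. }
  destruct (H A B u Ju f); eauto.
Qed.

(** * Composites of two maps as transfinite compositions *)

Inductive stage := start | middle | finish.

Definition stage_le (i j : stage) : Prop :=
  match i, j with
  | start, _ | middle, middle | middle, finish | finish, finish => True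
  | _, _ => False
  end.

Lemma stage_well_order : well_order stage_le.
Proof.
  constructor.
  - intros []; exact Logic.I.
  - intros [] []; simpl; tauto.
  - intros [] [] []; simpl; tauto.
  - intros P HP.
    destruct (classic (P start)) as [H0|H0].
    { exists start. split; [exact H0|]. intros [] _; exact Logic.I. }
    destruct (classic (P middle)) as [H1|H1].
    { exists middle. split; [exact H1|].
      intros [] Hj; simpl; tauto. }
    destruct HP as [[] Hi]; try contradiction.
    exists finish. split; [exact Hi|]. intros [] Hj; simpl; tauto.
Qed.

Section TwoSteps.
Variables (A B D : ob C) (f : hom A B) (g : hom B D).

Definition stage_ob (i : stage) : ob C :=
  match i with start => A | middle => B | finish => D end.

Definition stage_map (i j : stage) : stage_le i j -> hom (stage_ob i) (stage_ob j) :=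
  match i, j return stage_le i j -> hom (stage_ob i) (stage_ob j) with
  | start, start => fun _ => id A
  | start, middle => fun _ => f
  | start, finish => fun _ => g ∘ f
  | middle, middle => fun _ => id B
  | middle, finish => fun _ => g
  | finish, finish => fun _ => id D
  | middle, start | finish, start | finish, middle =>
      fun h => match h with end
  end.

Definition stage_chain : chain C stage_le.
Proof.
  refine (@Chain C stage stage_le stage_ob stage_map _ _).
  - intros []; reflexivity.
  - intros [] [] []; simpl; intros hij hjk hik;
      try contradiction; rewrite ?comp_id_l, ?comp_id_r; reflexivity.
Defined.

(** The three-element ordinal has no limit stage, so continuity is vacuous, and the colimit is the
    last object. *)
Lemma two_step_composition (K : map_class C) :
  K _ _ f -> K _ _ g -> transfinite_composition K (g ∘ f).
Proof.
  intros Kf Kg.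
  assert (top : forall i, stage_le i finish) by (intros []; exact Logic.I).
  refine (@TransfiniteComposition C K stage stage_le stage_chain start D
    (fun i _ => @stage_map i finish (top i)) stage_well_order _ _ _ _).
  - intros []; exact Logic.I.
  - intros [] [] h [[_ Hne] Hs]; simpl in *; try contradiction; try congruence;
      try assumption.
    (* [finish] is not the successor of [start], since [middle] lies in between. *)
    exfalso. apply (Hs middle). split; [exact Logic.I|discriminate].
  - intros [] [Hl Hs].
    + exfalso. apply Hl. intros []; exact Logic.I.
    + exfalso. apply Hs. exists start. split; [split; [exact Logic.I|discriminate]|].
      intros [] [_ H]; try exact Logic.I. congruence.
    + exfalso. apply Hs. exists middle. split; [split; [exact Logic.I|discriminate]|].
      intros [] [H1 H]; try exact Logic.I; simpl in *; tauto || congruence.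
  - split.
    + intros i j h di dj. apply (@ch_comp C stage stage_le stage_chain i j finish).
    + intros Z d Hd. exists (d finish Logic.I). split.
      * intros i []. apply (Hd i finish (top i) Logic.I Logic.I).
      * intros h Hh. rewrite <- (Hh finish Logic.I). apply comp_id_r.
Qed.

End TwoSteps.
End CategoryLemmas.

(** * Cofibrations, cylinders and path objects in a model structure *)

Section ModelStructureLemmas.
Variables (C : category) (M : model_structure C).

(** The retract argument. *)
Lemma cof_of_lifts (A B : ob C) (i : hom A B) :
  (forall X Y (p : hom X Y), fib M p -> weq M p -> lifts i p) -> cof M i.
Proof.
  intros H. destruct (factor_cof_trivial_fib M i) as (Z & j & p & Hj & Fp & Wp & E).
  destruct (H Z B p Fp Wp j (id B)) as [h [Hi Hp]].
  { rewrite E, comp_id_l. reflexivity. }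
  apply (@cof_retract C M A B A Z i j); [|exact Hj].
  exists (id A), (id A), h, p. rewrite !comp_id_r, E. auto.
Qed.

Lemma cof_id (X : ob C) : cof M (id X).
Proof.
  apply cof_of_lifts. intros Y Z p _ _ f g E. exists f.
  split; [apply comp_id_r|]. rewrite E. apply comp_id_r.
Qed.

(** The inclusion is a pushout of the map from the initial object to [B]: a lift consists of the
    given [f] on [A] and of a lift on [B] provided by cofibrancy. *)
Lemma cof_coproduct_in (A B S : ob C) (i : hom A S) (j : hom B S) :
  is_coproduct i j -> cofibrant M B -> cof M i.
Proof.
  intros HS (O & o & HO & Co). apply cof_of_lifts.
  intros X Y p Fp Wp f g E.
  destruct (HO X) as [z _].
  destruct (cof_lifts_trivial_fib Co Fp Wp (f := z) (g := g ∘ j)) as [h [_ Hh]].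
  { apply initial_eq, HO. }
  destruct (HS X f h) as [k [[Ki Kj] _]]. exists k. split; [exact Ki|].
  apply (coproduct_eq HS); rewrite <- comp_assoc; congruence.
Qed.

Section Homotopies.
Variables (X S : ob C) (i j : hom X S) (fold : hom S X).
Hypothesis S_coproduct : is_coproduct i j.
Hypothesis fold_i : fold ∘ i = id X.
Hypothesis fold_j : fold ∘ j = id X.
Hypothesis fold_weq : weq M fold.
Hypothesis id_weq : weq M (id X).

Lemma in0_weq : weq M i.
Proof.
  destruct (weq_two_out_of_three M i fold) as (_ & _ & H).
  apply H; [exact fold_weq|]. rewrite fold_i. exact id_weq.
Qed.

(** The sum [S] is itself a cylinder of [X], so no condition at all ties
    together the two ends of a homotopy. *)
Lemma all_left_homotopic (Y : ob C) (f g : hom X Y) : left_homotopic M f g.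
Proof.
  assert (E0 : fold ∘ id S ∘ i = id X) by (rewrite comp_id_r; exact fold_i).
  assert (E1 : fold ∘ id S ∘ j = id X) by (rewrite comp_id_r; exact fold_j).
  destruct (S_coproduct f g) as [h [[Hi Hj] _]].
  exists (Cylinder S_coproduct (cof_id S) fold_weq E0 E1), h. simpl.
  rewrite comp_id_r. auto.
Qed.

Hypothesis X_cofibrant : cofibrant M X.

(** As a cofibration and a weak equivalence, [i] lifts against the path fibration [e]. The map [k]
    restricts to [(g, g)] along [i], where [c ∘ g] lifts it, and to [(f, g)] along [j], so the lift
    restricted along [j] is the homotopy. *)
Lemma all_right_homotopic (Y Q : ob C) (p q : hom Q Y) (f g : hom X Y) :
  is_product p q -> right_homotopic M f g.
Proof.
  intros HQ.
  destruct (HQ Y (id Y) (id Y)) as [diag [[Dp Dq] _]].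
  destruct (factor_trivial_cof_fib M diag) as (P & c & e & _ & Wc & Fe & E).
  destruct (S_coproduct g f) as [k0 [[K0i K0j] _]].
  destruct (HQ S k0 (g ∘ fold)) as [k [[Kp Kq] _]].
  assert (P0 : p ∘ e ∘ c = id Y) by (rewrite <- comp_assoc, E; exact Dp).
  assert (P1 : q ∘ e ∘ c = id Y) by (rewrite <- comp_assoc, E; exact Dq).
  destruct (trivial_cof_lifts_fib (cof_coproduct_in S_coproduct X_cofibrant)
    in0_weq Fe (f := c ∘ g) (g := k)) as [h [_ Hh]].
  { apply (product_eq HQ); rewrite !comp_assoc.
    - rewrite P0, Kp, K0i. apply comp_id_l.
    - rewrite P1, Kq, <- comp_assoc, fold_i, comp_id_l, comp_id_r. reflexivity. }
  exists (PathObject HQ Wc Fe P0 P1), (h ∘ j). simpl. split.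
  - rewrite <- K0j, <- Kp, <- Hh, !comp_assoc. reflexivity.
  - transitivity (q ∘ k ∘ j).
    + rewrite <- Hh, !comp_assoc. reflexivity.
    + rewrite Kq, <- comp_assoc, fold_j. apply comp_id_r.
Qed.

(** The map [h] with components [k] and the identity is a weak equivalence because [h ∘ j] is an
    identity and [j] is a weak equivalence; hence so is [k = h ∘ i]. *)
Lemma endomorphism_weq (k : hom X X) : weq M k.
Proof.
  assert (Wj : weq M j).
  { destruct (weq_two_out_of_three M j fold) as (_ & _ & H).
    apply H; [exact fold_weq|]. rewrite fold_j. exact id_weq. }
  destruct (S_coproduct k (id X)) as [h [[Hi Hj] _]].
  destruct (weq_two_out_of_three M j h) as (_ & H & _).
  rewrite <- Hi. apply (weq_two_out_of_three M i h); [apply in0_weq|].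
  apply H; [exact Wj|]. rewrite Hj. exact id_weq.
Qed.

(** [f] is a retract of the endomorphism [f ∘ g] of [X]. This yields an actual weak equivalence
    without passing through the homotopy category. *)
Lemma retraction_weq (A : ob C) (f : hom A X) (g : hom X A) :
  g ∘ f = id A -> weq M f.
Proof.
  intros E. apply (@weq_retract C M A X X X f (f ∘ g)); [|apply endomorphism_weq].
  exists f, g, (id X), (id X).
  rewrite E, !comp_id_l, <- comp_assoc, E, comp_id_r. auto.
Qed.

End Homotopies.
End ModelStructureLemmas.

(** * Wedges of paths with a single label *)

Section Fans.
Variables (Sigma : Type) (x : Sigma).

(** The wedge of the paths [x ... x] of lengths [d b].  The state [None] is the
    base; every other state is identified with the only action that leads to
    it. *)

Section Fan.
Variables (I : Type) (d : I -> nat).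

Record node := Node { branch : I; level : nat; level_lt : level < d branch }.

Lemma node_ext (m n : node) : branch m = branch n -> level m = level n -> m = n.
Proof.
  destruct m as [b k H], n as [c l H']; simpl. intros -> ->.
  f_equal. apply proof_irrelevance.
Qed.

Definition parent (n : node) : option node :=
  let (b, k, H) := n in
  match k return k < d b -> option node with
  | 0 => fun _ => None
  | S k' => fun H => Some (Node (Nat.lt_succ_l _ _ H))
  end H.

Definition depth (a : option node) : nat :=
  match a with None => 0 | Some n => S (level n) end.

Lemma depth_eq_0 (a : option node) : depth a = 0 -> a = None.
Proof. destruct a; [discriminate|reflexivity]. Qed.

Lemma depth_parent (n : node) : depth (parent n) = level n.
Proof. destruct n as [b [|k] H]; reflexivity. Qed.

Lemma branch_parent (m n : node) : parent n = Some m -> branch n = branch m.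
Proof. destruct n as [b [|k] H]; simpl; intros [= <-]; reflexivity. Qed.

(** Detects the end of a branch: this is what forbids continuing the short branch in
    [fans_not_bisimilar]. *)
Lemma parent_not_top (m n : node) : parent n = Some m -> S (level m) < d (branch m).
Proof. destruct n as [b [|k] H]; simpl; intros [= <-]; exact H. Qed.

Definition fan_presystem : presystem Sigma.
Proof.
  refine (@Presystem Sigma (option node) node (fun _ => x)
    (fun a us b => exists n, us = [n] /\ a = parent n /\ b = Some n) _).
  intros a b [n [H _]]. discriminate H.
Defined.

(** Every transition has a single action, so the multiset, patching and CSA2 axioms are vacuous;
    CSA1 holds because the target state determines the action. *)
Lemma fan_csts : is_csts fan_presystem.
Proof.
  constructor.
  - intros a b us vs Hlen _ [n [-> _]]. simpl in Hlen. lia.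
  - intros a b n1 n2 [|u us] [|v vs] ws Hu Hv _ [n [E _]]; try congruence.
    destruct us; discriminate E.
  - intros n. exists (parent n), (Some n), n. auto.
  - intros a b [|u us] [|v vs] Hu Hv [n [E _]]; try congruence.
    destruct us; discriminate E.
  - intros a b u v [m [[= <-] [_ Hm]]] [n [[= <-] [_ Hn]]] _. congruence.
Qed.

Definition fan_pointed : pointed Sigma :=
  Pointed fan_csts (None : state fan_presystem).

(** Lengths below [d b] are allowed so that every node is the end of such a path, which gives
    star-shapedness. *)
Definition branch_map (b : I) (m : nat) (Hm : m <= d b) :
  pointed_map (path_pointed (repeat x m)) fan_pointed.
Proof.
  assert (Hs : forall k, S k <= length (repeat x m) -> k < d b).
  { intros k. rewrite repeat_length. lia. }
  assert (Ha : forall k y, nth_error (repeat x m) k = Some y -> k < d b).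
  { intros k y H. apply Hs, nth_error_Some. congruence. }
  unshelve refine (@PointedMap _ (path_pointed (repeat x m)) fan_pointed
    (@SystemMap _ (path_presystem (repeat x m)) fan_presystem
      (fun a => let (k, Hk) := a in
        match k return k <= length (repeat x m) -> option node with
        | 0 => fun _ => None
        | S k' => fun H => Some (Node (Hs k' H))
        end Hk)
      (fun u => Node (Ha (snd (proj1_sig u)) (fst (proj1_sig u)) (proj2_sig u)))
      _ _) eq_refl).
  - intros [[y k] Hk]. simpl in *. symmetry.
    apply (repeat_spec m x), (nth_error_In _ _ Hk).
  - intros [a Hak] us [c Hck] [[[y k] Hk] [-> [E E']]]. simpl in *. subst a c.
    eexists. split; [reflexivity|]. split.
    + destruct k; [reflexivity|]. simpl. f_equal. apply node_ext; reflexivity.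
    + f_equal. apply node_ext; reflexivity.
Defined.

Lemma fan_star_shaped : star_shaped fan_pointed.
Proof.
  intros [[b k H]|].
  - exists (repeat x (S k)), (branch_map H). simpl. f_equal.
    apply node_ext; simpl; [reflexivity|apply repeat_length].
  - exists [].
    unshelve eexists (@PointedMap _ (path_pointed []) fan_pointed
      (@SystemMap _ (path_presystem []) fan_presystem (fun _ => None) _ _ _) _).
    + intros [[y i] Hi]. destruct i; discriminate Hi.
    + intros [[y i] Hi]. exfalso. destruct i; discriminate Hi.
    + intros a us b [[[y i] Hi] _]. exfalso. destruct i; discriminate Hi.
    + reflexivity.
    + reflexivity.
Qed.

Definition fan : ob (CSTS_star Sigma) := StarSystem fan_star_shaped.

Definition fan_state (X : pointed Sigma) (s : node -> state X) (a : option node) :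
  state X := match a with None => base X | Some n => s n end.

Definition fan_map (X : pointed Sigma) (s : node -> state X) (u : node -> action X)
    (Hl : forall n, label (u n) = x)
    (Ht : forall n, trans (fan_state s (parent n)) [u n] (s n)) :
  pointed_map fan_pointed X.
Proof.
  refine (@PointedMap _ fan_pointed X
    (@SystemMap _ fan_presystem X (fan_state s) u Hl _) eq_refl).
  intros a us b [n [-> [-> ->]]]. apply Ht.
Defined.

Lemma fan_map_ext (X : pointed Sigma) (f g : pointed_map fan_pointed X) :
  (forall n, on_state f (Some n) = on_state g (Some n)) ->
  (forall n : node, on_action f n = on_action g n) -> f = g.
Proof.
  intros Hs Ha. apply pointed_map_ext; [|exact Ha].
  intros [n|]; [apply Hs|].
  transitivity (base X); [|symmetry]; apply (on_base (X := fan_pointed)).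
Qed.

Lemma fan_target (X : pointed Sigma) (f : pointed_map X fan_pointed)
    (a b : state X) (u : action X) :
  trans a [u] b ->
  on_state f a = parent (on_action f u) /\ on_state f b = Some (on_action f u).
Proof.
  intros H. apply (on_trans f) in H. destruct H as [n [E [Ha Hb]]].
  injection E as <-. auto.
Qed.

(** The action of a fan transition is its target state, and every action of [X] occurs in a
    transition, so the values on states determine those on actions. *)
Lemma to_fan_ext (X : pointed Sigma) (f g : pointed_map X fan_pointed) :
  (forall a, on_state f a = on_state g a) -> f = g.
Proof.
  intros H. apply pointed_map_ext; [exact H|]. intros u.
  destruct (csts_all_actions_used (underlying_csts X) u) as (a & b & T).
  destruct (fan_target f T) as [_ Hf]. destruct (fan_target g T) as [_ Hg].
  rewrite H, Hg in Hf. congruence.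
Qed.

End Fan.

(** * Paths in fans: depth and branch *)

Lemma path_step (w : list Sigma) (k : nat) (H : k <= length w) (H' : S k <= length w) :
  exists u, trans (exist _ k H : state (path_presystem w)) [u] (exist _ (S k) H').
Proof.
  destruct (nth_error w k) as [y|] eqn:E.
  - exists (exist _ (y, k) E), (exist _ (y, k) E). auto.
  - apply nth_error_None in E. lia.
Qed.

(** Each transition of a fan increases the depth by one, and the base state has depth zero. *)
Lemma path_depth (I : Type) (d : I -> nat) (w : list Sigma)
    (f : pointed_map (path_pointed w) (fan_pointed d)) (a : state (path_pointed w)) :
  depth (on_state f a : option (node d)) = proj1_sig a.
Proof.
  destruct a as [k Hk]. simpl. induction k as [|k IH].
  - replace (exist _ 0 Hk : state (path_pointed w)) with (base (path_pointed w)).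
    + exact (f_equal (@depth I d) (on_base f)).
    + apply eq_sig_hprop; [intros; apply proof_irrelevance|reflexivity].
  - destruct (path_step (Nat.lt_le_incl _ _ Hk) Hk) as [u T].
    destruct (fan_target f T) as [Ha Hb].
    specialize (IH (Nat.lt_le_incl _ _ Hk)). simpl in *.
    rewrite Ha, depth_parent in IH. rewrite Hb. simpl. congruence.
Qed.

(** Once a path has left the base it never returns, its depth being positive, and a transition
    between two nodes stays in the same branch. The first alternative is the empty path. *)
Lemma path_branch (I : Type) (d : I -> nat) (w : list Sigma)
    (f : pointed_map (path_pointed w) (fan_pointed d)) :
  (forall a, on_state f a = None) \/
  exists b, forall a n, on_state f a = Some n -> branch n = b.
Proof.
  assert (H0 : forall H : 0 <= length w, on_state f (exist _ 0 H) = None).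
  { intros H. apply depth_eq_0. exact (path_depth f (exist _ 0 H)). }
  destruct (Nat.eq_0_gt_0_cases (length w)) as [Hw|Hw].
  { left. intros [k Hk]. assert (k = 0) as -> by lia. apply H0. }
  right. pose proof (path_depth f (exist _ 1 Hw)) as E1.
  destruct (on_state f (exist _ 1 Hw)) as [n1|] eqn:F1; [|discriminate E1].
  exists (branch n1). intros [k Hk]. induction k as [|k IH]; intros n Hn.
  - rewrite H0 in Hn. discriminate Hn.
  - destruct (path_step (Nat.lt_le_incl _ _ Hk) Hk) as [u T].
    destruct (fan_target f T) as [Ha Hb].
    rewrite Hn in Hb. injection Hb as Hb. subst n.
    destruct k as [|k].
    + rewrite (proof_irrelevance _ Hk Hw) in Hn. congruence.
    + destruct (parent (on_action f u)) as [m|] eqn:P.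
      * exact (eq_trans (branch_parent P) (IH _ _ Ha)).
      (* The source [S k] has positive depth, so it is not sent to the base. *)
      * pose proof (path_depth f (exist _ (S k) (Nat.lt_le_incl _ _ Hk))) as E.
        rewrite Ha in E. discriminate E.
Qed.

(** Star-shapedness makes [a] the end of a path, and both depths equal the length of that path. *)
Lemma star_depth (X : star_system Sigma) (I J : Type) (d : I -> nat) (e : J -> nat)
    (f : pointed_map X (fan_pointed d)) (g : pointed_map X (fan_pointed e))
    (a : state X) :
  depth (on_state f a : option (node d)) = depth (on_state g a : option (node e)).
Proof.
  destruct (star_shapedP a) as (w & h & <-).
  pose proof (path_depth (pointed_map_comp f h) (path_end w)) as Ef.
  pose proof (path_depth (pointed_map_comp g h) (path_end w)) as Eg.
  simpl in *. congruence.
Qed.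

(** * Maps of fans induced by functions on branches; coproducts and codiagonals *)

Section Reindex.
Variables (I J : Type) (d : I -> nat) (e : J -> nat) (r : I -> J).
Hypothesis r_le : forall i, d i <= e (r i).

Definition reindex_node (n : node d) : node e :=
  Node (Nat.lt_le_trans _ _ _ (level_lt n) (r_le (branch n))).

Definition reindex : @hom (CSTS_star Sigma) (fan d) (fan e).
Proof.
  refine (@fan_map I d (fan_pointed e) (fun n => Some (reindex_node n))
    reindex_node (fun _ => eq_refl) _).
  intros n. exists (reindex_node n). split; [reflexivity|]. split; [|reflexivity].
  destruct n as [b [|k] H]; [reflexivity|]. simpl. f_equal.
  apply node_ext; reflexivity.
Defined.

End Reindex.

Definition sum_fun (I J : Type) (d : I -> nat) (e : J -> nat) (c : I + J) : nat :=
  match c with inl i => d i | inr j => e j end.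

Definition fan_inl (I J : Type) (d : I -> nat) (e : J -> nat) :
    @hom (CSTS_star Sigma) (fan d) (fan (sum_fun d e)) :=
  @reindex I (I + J) d (sum_fun d e) inl (fun _ => le_n _).

Definition fan_inr (I J : Type) (d : I -> nat) (e : J -> nat) :
    @hom (CSTS_star Sigma) (fan e) (fan (sum_fun d e)) :=
  @reindex J (I + J) e (sum_fun d e) inr (fun _ => le_n _).

(** The branches of the sum are those of both fans, and the only shared state, the base, is sent to
    [base Z] by [f] and [g] alike. *)
Lemma fan_coproduct (I J : Type) (d : I -> nat) (e : J -> nat) :
  is_coproduct (fan_inl d e) (fan_inr d e).
Proof.
  intros Z f g.
  (* The bound [H] can be reused as it stands, since [sum_fun d e] computes on [inl] and [inr]. *)
  pose (split_node := fun (T : Type) (l : node d -> T) (r : node e -> T)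
      (n : node (sum_fun d e)) =>
    match n with
    | @Node _ _ (inl i) k H => l (@Node I d i k H)
    | @Node _ _ (inr j) k H => r (@Node J e j k H)
    end).
  pose (fp := f : pointed_map (fan_pointed d) Z).
  pose (gp := g : pointed_map (fan_pointed e) Z).
  assert (f0 : on_state fp None = base Z) by apply (on_base fp).
  assert (g0 : on_state gp None = base Z) by apply (on_base gp).
  unshelve eexists (@fan_map (I + J) (sum_fun d e) Z
    (split_node _ (fun n => on_state fp (Some n)) (fun n => on_state gp (Some n)))
    (split_node _ (fun n : node d => on_action fp n)
       (fun n : node e => on_action gp n)) _ _).
  - intros [[i|j] k H]; simpl.
    + apply (on_label fp).
    + apply (on_label gp).
  - intros [[i|j] k H]; simpl.
    + assert (T : trans (on_state fp (parent (@Node I d i k H)))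
        [on_action fp (@Node I d i k H)] (on_state fp (Some (@Node I d i k H)))).
      { apply (on_trans fp (us := [_])). eexists. auto. }
      (* At level zero the source is the base, given as [base Z] by [fan_state] and as the image of
         [None] by [f]. *)
      destruct k; simpl in *; [rewrite <- f0|]; exact T.
    + assert (T : trans (on_state gp (parent (@Node J e j k H)))
        [on_action gp (@Node J e j k H)] (on_state gp (Some (@Node J e j k H)))).
      { apply (on_trans gp (us := [_])). eexists. auto. }
      destruct k; simpl in *; [rewrite <- g0|]; exact T.
  - split.
    + split; apply fan_map_ext; intros [b k H]; simpl; repeat f_equal;
        apply proof_irrelevance.
    + intros h [<- <-].
      pose (hp := h : pointed_map (fan_pointed (sum_fun d e)) Z).
      apply fan_map_ext; intros [[i|j] k H].
      * apply (f_equal (fun n => on_state hp (Some n))), node_ext; reflexivity.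
      * apply (f_equal (fun n => on_state hp (Some n))), node_ext; reflexivity.
      * apply (f_equal (fun n : node (sum_fun d e) => on_action hp n)), node_ext;
          reflexivity.
      * apply (f_equal (fun n : node (sum_fun d e) => on_action hp n)), node_ext;
          reflexivity.
Qed.

Definition fan_fold (I : Type) (d : I -> nat) :
    @hom (CSTS_star Sigma) (fan (sum_fun d d)) (fan d).
Proof.
  refine (@reindex (I + I) I (sum_fun d d) d
    (fun c => match c with inl i | inr i => i end) _).
  intros [i|i]; apply le_n.
Defined.

Lemma fan_fold_inl (I : Type) (d : I -> nat) : fan_fold d ∘ fan_inl d d = id _.
Proof.
  apply (@to_fan_ext I d). intros [[b k H]|]; [|reflexivity].
  simpl. f_equal. apply node_ext; reflexivity.
Qed.

Lemma fan_fold_inr (I : Type) (d : I -> nat) : fan_fold d ∘ fan_inr d d = id _.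
Proof.
  apply (@to_fan_ext I d). intros [[b k H]|]; [|reflexivity].
  simpl. f_equal. apply node_ext; reflexivity.
Qed.

(** The hypothesis admits the base [None], which belongs to both summands. *)
Lemma fan_inl_fold (I : Type) (d : I -> nat) (a : option (node (sum_fun d d))) :
  (forall n, a = Some n -> exists b, branch n = inl b) ->
  on_state (fan_inl d d ∘ fan_fold d : pointed_map (fan_pointed _) (fan_pointed _)) a
    = a.
Proof.
  destruct a as [[c k H]|]; [|reflexivity].
  intros Hc. destruct (Hc _ eq_refl) as [b Hb]. simpl in *. subst c.
  f_equal. apply node_ext; reflexivity.
Qed.

Lemma fan_inr_fold (I : Type) (d : I -> nat) (a : option (node (sum_fun d d))) :
  (forall n, a = Some n -> exists b, branch n = inr b) ->
  on_state (fan_inr d d ∘ fan_fold d : pointed_map (fan_pointed _) (fan_pointed _)) a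
    = a.
Proof.
  destruct a as [[c k H]|]; [|reflexivity].
  intros Hc. destruct (Hc _ eq_refl) as [b Hb]. simpl in *. subst c.
  f_equal. apply node_ext; reflexivity.
Qed.

Lemma fan_fold_injective (I : Type) (d : I -> nat) :
  injective path_extension (fan_fold d).
Proof.
  apply (codiagonal_injective (fan_fold_inl d) (fan_fold_inr d)).
  intros A B u [w w'] f.
  (* A path has its nodes in one branch, hence in one summand; when it never leaves the base, either
     summand would do. *)
  destruct (path_branch f) as [Hf|[[b|b] Hb]]; [left|left|right];
    apply (@to_fan_ext (I + I)); intros a;
    [apply (@fan_inl_fold I d (on_state f a))
    |apply (@fan_inl_fold I d (on_state f a))
    |apply (@fan_inr_fold I d (on_state f a))]; intros n Hn; try (eauto; fail).
  pose proof (eq_trans (eq_sym (Hf a)) Hn) as E. discriminate E.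
Qed.

(** * Products of fans *)

(** Two paths on the same letter run in parallel only as long as the shorter one, whence one branch
    of minimal length for each pair of branches. *)
Definition min_fun (I J : Type) (d : I -> nat) (e : J -> nat) (c : I * J) : nat :=
  Nat.min (d (fst c)) (e (snd c)).

Definition fan_fst (I J : Type) (d : I -> nat) (e : J -> nat) :
    @hom (CSTS_star Sigma) (fan (min_fun d e)) (fan d) :=
  @reindex (I * J) I (min_fun d e) d fst (fun _ => Nat.le_min_l _ _).

Definition fan_snd (I J : Type) (d : I -> nat) (e : J -> nat) :
    @hom (CSTS_star Sigma) (fan (min_fun d e)) (fan e) :=
  @reindex (I * J) J (min_fun d e) e snd (fun _ => Nat.le_min_r _ _).

(** Taking the minimum of the levels makes pairing total and compatible with
    [parent]; only pairs at equal levels occur. *)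
Definition pair_node (I J : Type) (d : I -> nat) (e : J -> nat)
    (m : node d) (n : node e) : node (min_fun d e).
Proof.
  refine (@Node _ (min_fun d e) (branch m, branch n) (Nat.min (level m) (level n)) _).
  unfold min_fun; simpl. pose proof (level_lt m). pose proof (level_lt n). lia.
Defined.

Definition pair_state (I J : Type) (d : I -> nat) (e : J -> nat)
    (a : option (node d)) (b : option (node e)) : option (node (min_fun d e)) :=
  match a, b with Some m, Some n => Some (pair_node m n) | _, _ => None end.

Lemma parent_pair (I J : Type) (d : I -> nat) (e : J -> nat)
    (m : node d) (n : node e) :
  parent (pair_node m n) = pair_state (parent m) (parent n).
Proof.
  destruct m as [b k H], n as [c l H']. unfold pair_node. simpl.
  destruct k as [|k], l as [|l]; try reflexivity.
  simpl. f_equal. apply node_ext; reflexivity.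
Qed.

Lemma fan_fst_pair (I J : Type) (d : I -> nat) (e : J -> nat)
    (a : option (node d)) (b : option (node e)) :
  depth a = depth b ->
  on_state (fan_fst d e : pointed_map (fan_pointed _) (fan_pointed _)) (pair_state a b)
    = a.
Proof.
  destruct a as [[c k H]|], b as [[c' l H']|]; intros E; try discriminate E;
    try reflexivity.
  simpl in *. f_equal. apply node_ext; simpl; [reflexivity|lia].
Qed.

Lemma fan_snd_pair (I J : Type) (d : I -> nat) (e : J -> nat)
    (a : option (node d)) (b : option (node e)) :
  depth a = depth b ->
  on_state (fan_snd d e : pointed_map (fan_pointed _) (fan_pointed _)) (pair_state a b)
    = b.
Proof.
  destruct a as [[c k H]|], b as [[c' l H']|]; intros E; try discriminate E;
    try reflexivity.
  simpl in *. f_equal. apply node_ext; simpl; [reflexivity|lia].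
Qed.

Lemma pair_fst_snd (I J : Type) (d : I -> nat) (e : J -> nat)
    (a : option (node (min_fun d e))) :
  pair_state
    (on_state (fan_fst d e : pointed_map (fan_pointed _) (fan_pointed _)) a)
    (on_state (fan_snd d e : pointed_map (fan_pointed _) (fan_pointed _)) a) = a.
Proof.
  destruct a as [[[b c] k H]|]; [|reflexivity].
  simpl. f_equal. apply node_ext; simpl; [reflexivity|lia].
Qed.

(** Only pairs of nodes at the same level are reachable, since all the edges
    carry the same label. *)
Lemma fan_product (I J : Type) (d : I -> nat) (e : J -> nat) :
  is_product (fan_fst d e) (fan_snd d e).
Proof.
  intros Z f g.
  pose (fp := f : pointed_map Z (fan_pointed d)).
  pose (gp := g : pointed_map Z (fan_pointed e)).
  unshelve eexists (@PointedMap _ Z (fan_pointed (min_fun d e))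
    (@SystemMap _ Z (fan_presystem (min_fun d e))
      (fun a => pair_state (on_state fp a) (on_state gp a))
      (fun u => pair_node (on_action fp u) (on_action gp u)) _ _) _).
  - intros u. apply (on_label fp).
  - intros a us b T.
    pose proof (on_trans fp T) as (n & Eus & Ha & Hb).
    pose proof (on_trans gp T) as (n' & Eus' & Ha' & Hb').
    destruct us as [|u [|u' us]]; simpl in *; try discriminate.
    injection Eus as <-. injection Eus' as <-.
    eexists. split; [reflexivity|].
    rewrite Ha, Ha', Hb, Hb', parent_pair. auto.
  - exact (f_equal (fun a : option (node d) =>
      pair_state a (on_state gp (base Z) : option (node e))) (on_base fp)).
  - split.
    + split.
      * apply (@to_fan_ext I d). intros a. apply fan_fst_pair, (star_depth fp gp).
      * apply (@to_fan_ext J e). intros a. apply fan_snd_pair, (star_depth fp gp).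
    + intros h [<- <-]. apply (@to_fan_ext (I * J) (min_fun d e)). intros a.
      apply pair_fst_snd.
Qed.

(** * Fans as cell complexes *)

(** Without nodes only the base is left. This serves both for the fan with no branches and for the
    fan with one branch of length zero, which is the empty path. *)
Lemma empty_fan_initial (I : Type) (d : I -> nat) :
  (forall i, d i = 0) -> is_initial (fan d).
Proof.
  intros H X.
  assert (E : node d -> False).
  { intros [b k Hk]. rewrite H in Hk. inversion Hk. }
  unshelve eexists (@fan_map I d X (fun n => False_rect _ (E n))
    (fun n => False_rect _ (E n)) _ _).
  - intros n. destruct (E n).
  - intros n. destruct (E n).
  - split; [exact Logic.I|]. intros g _.
    apply fan_map_ext; intros n; destruct (E n).
Qed.

(** The node at level [k] is the state [k + 1], since the base is the state [0]. With [fan_of_path],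
    this identifies a fan with one branch with a path, so that coproducts of fans describe the
    attachment of a path. *)
Definition path_of_fan (m : nat) :
  @hom (CSTS_star Sigma) (fan (fun _ : unit => m)) (path (repeat x m)).
Proof.
  assert (Hn : forall n : node (fun _ : unit => m),
    nth_error (repeat x m) (level n) = Some x).
  { intros [b k H]. apply nth_error_repeat, H. }
  assert (Hs : forall n : node (fun _ : unit => m), S (level n) <= length (repeat x m)).
  { intros [b k H]. rewrite repeat_length. exact H. }
  refine (@fan_map unit (fun _ => m) (path_pointed (repeat x m))
    (fun n => exist _ (S (level n)) (Hs n)) (fun n => exist _ (x, level n) (Hn n))
    (fun _ => eq_refl) _).
  intros n. eexists. split; [reflexivity|]. split; [|reflexivity].
  destruct n as [b [|k] H]; reflexivity.
Defined.

Definition fan_of_path (m : nat) :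
    @hom (CSTS_star Sigma) (path (repeat x m)) (fan (fun _ : unit => m)) :=
  @branch_map unit (fun _ => m) tt m (le_n m).

Lemma path_of_fan_of_path (m : nat) : path_of_fan m ∘ fan_of_path m = id _.
Proof.
  apply pointed_map_ext.
  - intros [[|k] Hk]; apply eq_sig_hprop;
      reflexivity || (intros; apply proof_irrelevance).
  - intros [[y k] Hk]. apply eq_sig_hprop; [intros; apply proof_irrelevance|].
    simpl. f_equal. symmetry. apply (repeat_spec m x), (nth_error_In _ _ Hk).
Qed.

Lemma fan_of_path_of_fan (m : nat) : fan_of_path m ∘ path_of_fan m = id _.
Proof.
  apply (@to_fan_ext unit (fun _ => m)). intros [[[] k H]|]; [|reflexivity].
  simpl. f_equal. apply node_ext; reflexivity.
Qed.

Lemma empty_path_initial : @is_initial (CSTS_star Sigma) (path []).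
Proof.
  apply (initial_iso (path_of_fan_of_path 0)), empty_fan_initial. reflexivity.
Qed.

(** The path [x ... x] extends the empty path, which is initial, so adding a branch at the base is a
    pushout of that extension. *)
Lemma fan_inl_pushout (I : Type) (d : I -> nat) (m : nat) :
  pushout_of path_extension (fan_inl d (fun _ : unit => m)).
Proof.
  destruct (empty_path_initial (fan d)) as [a _].
  exists (path []), (path ([] ++ repeat x m)), (path_incl [] (repeat x m)), a,
    (fan_inr d (fun _ : unit => m) ∘ fan_of_path m).
  split; [constructor|]. apply coproduct_pushout; [apply empty_path_initial|].
  apply (coproduct_iso (fan_of_path_of_fan m) (path_of_fan_of_path m)).
  apply fan_coproduct.
Qed.

(** The empty summand is the starting point of the cell complex. *)
Definition two_lengths (k m : nat) : Empty_set + unit + unit -> nat :=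
  sum_fun (sum_fun (fun b : Empty_set => match b with end) (fun _ : unit => k))
    (fun _ : unit => m).

(** The two branches are attached one after the other, starting from the fan with no branches. *)
Lemma fan_two_lengths_cell_complex (k m : nat) :
  cell_complex path_extension (fan (two_lengths k m)).
Proof.
  eexists (fan (fun b : Empty_set => match b with end)), _. split.
  - apply empty_fan_initial. intros [].
  - apply two_step_composition; apply fan_inl_pushout.
Qed.

(** * The path [xx] and its wedge with [x] *)

(** A branch of length zero has no nodes, so this fan is a single path, whose states are told apart
    by their depth. *)
Lemma single_branch_eq (k : nat) (a b : option (node (two_lengths k 0))) :
  depth a = depth b -> a = b.
Proof.
  intros E.
  destruct a as [[[[[]|[]]|[]] l H]|], b as [[[[[]|[]]|[]] l' H']|];
    simpl in *; try lia; try reflexivity.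
  f_equal. apply node_ext; simpl; [reflexivity|lia].
Qed.

Definition second_branch_incl :
  @hom (CSTS_star Sigma) (fan (two_lengths 2 0)) (fan (two_lengths 2 1)).
Proof.
  refine (@reindex _ _ (two_lengths 2 0) (two_lengths 2 1) (fun b => b) _).
  intros [[[]|[]]|[]]; simpl; lia.
Defined.

(** The additional [x] is sent to the first [x] of the long branch. *)
Definition second_branch_collapse :
  @hom (CSTS_star Sigma) (fan (two_lengths 2 1)) (fan (two_lengths 2 0)).
Proof.
  refine (@reindex _ _ (two_lengths 2 1) (two_lengths 2 0)
    (fun _ => inl (inr tt)) _).
  intros [[[]|[]]|[]]; simpl; lia.
Defined.

Lemma second_branch_retraction : second_branch_collapse ∘ second_branch_incl = id _.
Proof.
  apply (@to_fan_ext _ (two_lengths 2 0)). intros a.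
  apply single_branch_eq. destruct a; reflexivity.
Qed.

(** The short branch of the second fan performs [x] and stops, whereas in the
    first fan every [x] can be followed by another one. *)
Lemma fans_not_bisimilar :
  ~ bisimilar path_extension (fan (two_lengths 2 0)) (fan (two_lengths 2 1)).
Proof.
  intros (Z & p & q & Hp & Hq).
  (* The path [x] along the short branch; injectivity of [q] lifts it to [Z]. *)
  pose (g := @branch_map _ (two_lengths 2 1) (inr tt) 1 (le_n 1)
    : @hom (CSTS_star Sigma) (path ([] ++ [x])) (fan (two_lengths 2 1))).
  destruct (empty_path_initial Z) as [z _].
  destruct (Hq _ _ _ (PathExtension [] [x]) z g) as [h [_ Eh]].
  { apply initial_eq, empty_path_initial. }
  (* In the first fan the image of the lifted path under [p] extends to [xx]; injectivity of [p]
     then extends the path in [Z] itself. *)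
  pose (m := @branch_map _ (two_lengths 2 0) (inl (inr tt)) 2 (le_n 2)
    : @hom (CSTS_star Sigma) (path ([x] ++ [x])) (fan (two_lengths 2 0))).
  destruct (Hp _ _ _ (PathExtension [x] [x]) h m) as [h' [Eh' _]].
  (* Both maps go into a fan with a single nonempty branch, where the depth decides. *)
  { apply (@to_fan_ext _ (two_lengths 2 0)). intros a.
    apply single_branch_eq, (@star_depth (path [x])). }
  (* [k] follows [xx] in the second fan, yet its state [1] is the end of the short branch. *)
  pose (k := q ∘ h' : pointed_map (path_pointed [x; x]) (fan_pointed (two_lengths 2 1))).
  assert (H1 : 1 <= length [x; x]) by (simpl; lia).
  destruct (@path_step [x; x] 1 H1 (le_n 2)) as [u T].
  destruct (fan_target k T) as [Ha _].
  assert (Eg : on_state k (exist _ 1 H1) =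
    on_state (g : pointed_map (path_pointed [x]) (fan_pointed (two_lengths 2 1)))
      (exist _ 1 (le_n 1))).
  { rewrite <- Eh, <- Eh'. simpl. do 2 f_equal.
    apply eq_sig_hprop; [intros; apply proof_irrelevance|reflexivity]. }
  pose proof (parent_not_top (eq_trans (eq_sym Ha) Eg)) as H. simpl in H. lia.
Qed.

End Fans.

(** * Homotopy equivalence without bisimilarity, and the failure of causality *)

Theorem theorem12p4
  (Sigma : Type) (Sigma_infinite : ~ Finite Sigma)
  (realizes : ob (CSTS_star Sigma) -> Prop)
  (cell_complexes_realize : forall X : ob (CSTS_star Sigma),
    cell_complex path_extension X -> realizes X)
  (M : model_structure (CSTS_star Sigma))
  (cell_complexes_cofibrant : forall X : ob (CSTS_star Sigma),
    cell_complex path_extension X -> cofibrant M X)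
  (injective_weq : forall (X Y : ob (CSTS_star Sigma)) (f : hom X Y),
    injective path_extension f -> weq M f) :
  (exists A B : ob (CSTS_star Sigma),
    cell_complex path_extension A /\ cell_complex path_extension B /\
    homotopy_equivalent M A B /\ ~ bisimilar path_extension A B) /\
  ~ causal realizes M.
Proof.
  assert (HS : exists x : Sigma, True).
  (* An empty alphabet would be finite, enumerated by the empty list. *)
  { apply NNPP. intros H. apply Sigma_infinite. exists []. intros x.
    exfalso. apply H. exists x. exact Logic.I. }
  destruct HS as [x _].
  assert (fold_weq : forall I (d : I -> nat), weq M (fan_fold x d))
    by (intros I d; apply injective_weq, fan_fold_injective).
  assert (id_weq : forall X : ob (CSTS_star Sigma), weq M (id X))
    by (intros X; apply injective_weq, injective_id).
  (* These fans are cell complexes, hence cofibrant, their codiagonals are weak equivalences, and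
     they have the products that path objects require. *)
  assert (homotopic_endomorphisms : forall k m
      (f g : hom (fan x (two_lengths k m)) (fan x (two_lengths k m))),
    homotopic M f g).
  { intros k m f g. split.
    - exact (all_left_homotopic (@fan_coproduct _ x _ _ _ _) (@fan_fold_inl _ x _ _)
        (@fan_fold_inr _ x _ _) (fold_weq _ _) f g).
    - exact (all_right_homotopic (@fan_coproduct _ x _ _ _ _) (@fan_fold_inl _ x _ _)
        (@fan_fold_inr _ x _ _) (fold_weq _ _) (id_weq _)
        (cell_complexes_cofibrant _ (fan_two_lengths_cell_complex x k m))
        f g (@fan_product _ x _ _ _ _)). }
  split.
  - exists (fan x (two_lengths 2 0)), (fan x (two_lengths 2 1)).
    split; [apply fan_two_lengths_cell_complex|].
    split; [apply fan_two_lengths_cell_complex|].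
    split; [|apply fans_not_bisimilar].
    (* Both composites are endomorphisms, hence homotopic to the identities. *)
    exists (second_branch_incl x), (second_branch_collapse x). auto.
  (* Causality would make the two fans bisimilar, since [second_branch_incl], a section of the
     collapse, is a weak equivalence. *)
  - intros Hc. apply (fans_not_bisimilar (x := x)). apply Hc;
      try apply cell_complexes_realize, fan_two_lengths_cell_complex.
    apply rst_step. exists (second_branch_incl x).
    exact (retraction_weq (@fan_coproduct _ x _ _ _ _) (@fan_fold_inl _ x _ _)
      (@fan_fold_inr _ x _ _) (fold_weq _ _) (id_weq _) (@second_branch_retraction _ x)).
Qed.
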